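(* Let $\mathbb{K}$ be a field of characteristic zero and let $\mathcal M_{n\times m}$ be the space of $n\times m$ matrices over $\mathbb{K}$. Let $\mathcal F_p^r,\mathcal F_a^r$ (resp. $\mathcal F_p^c,\mathcal F_a^c$; resp. $\mathcal F_p,\mathcal F_a$) be the canonical Palindromicing and Antipalindromicing mappings of $\mathcal M_{n\times m}$ by rows (resp. by columns; resp. with respect to $\mathcal R$). Then: (1) They are given by $$\mathcal F_p^r:\mathcal M_{n\times m}\to W_p^r(n\times m),\ A\mapsto\tfrac12(A+\mathcal R_r(A)),\qquad \mathcal F_a^r:\mathcal M_{n\times m}\to W_a^r(n\times m),\ A\mapsto\tfrac12(A-\mathcal R_r(A)),$$ $$\mathcal F_p^c:\mathcal M_{n\times m}\to W_p^c(n\times m),\ A\mapsto\tfrac12(A+\mathcal R_c(A)),\qquad \mathcal F_a^c:\mathcal M_{n\times m}\to W_a^c(n\times m),\ A\mapsto\tfrac12(A-\mathcal R_c(A)),$$ $$\mathcal F_p:\mathcal M_{n\times m}\to \mathbf{PA}(n\times m),\ A\mapsto\tfrac12(A+\mathcal R(A)),\qquad \mathcal F_a:\mathcal M_{n\times m}\to \mathbf{aPA}(n\times m),\ A\mapsto\tfrac12(A-\mathcal R(A)).$$ (2) $\ker(\mathcal F_p^r)=\mathrm{Im}(\mathcal F_a^r)$, $\ker(\mathcal F_a^r)=\mathrm{Im}(\mathcal F_p^r)$, $\ker(\mathcal F_p^c)=\mathrm{Im}(\mathcal F_a^c)$, $\ker(\mathcal F_a^c)=\mathrm{Im}(\mathcal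 F_p^c)$, $\ker(\mathcal F_p)=\mathrm{Im}(\mathcal F_a)$, $\ker(\mathcal F_a)=\mathrm{Im}(\mathcal F_p)$. (3) $\mathcal F_p^r(A)=A(M_{\mathcal R}+I_n)$, $\mathcal F_a^r(A)=A(M_{\mathcal R}-I_n)$, $\mathcal F_p^c(A)=(M_{\mathcal R}+I_m)A$, $\mathcal F_a^c(A)=(M_{\mathcal R}-I_m)A$, $\mathcal F_p(A)=M_{\mathcal R}AM_{\mathcal R}+A$ and $\mathcal F_a(A)=M_{\mathcal R}AM_{\mathcal R}-A$.
   Context: For $A=(a_{ij})_{n\times m}$: $\mathcal R_r(A)=(a_{i(m+1-j)})_{n\times m}$ (reversing by rows), $\mathcal R_c(A)=(a_{(n+1-i)j})_{n\times m}$ (reversing by columns), $\mathcal R(A)=(a_{(n+1-i)(m+1-j)})_{n\times m}$ (reversing), so $\mathcal R=\mathcal R_r\circ\mathcal R_c$. $I_k$ is the $k\times k$ identity matrix. The matrix of $\mathcal R_r$, acting by right multiplication, is $(\delta_{i,m-j+1})_{m\times m}$, and the matrix of $\mathcal R_c$, acting by left multiplication, is $(\delta_{n-i+1,j})_{n\times n}$; for square matrices these coincide, and the reversing matrix is written $M_{\mathcal R}$. Subspaces of $\mathcal M_{n\times m}$: $W_p^r(n\times m)=\{A:\mathcal R_r(A)=A\}$, $W_a^r(n\times m)=\{A:\mathcal R_r(A)=-A\}$, $W_p^c(n\times m)=\{A:\mathcal R_c(A)=A\}$, $W_a^c(n\times m)=\{A:\mathcal R_c(A)=-A\}$, $\mathbf{PA}(n\times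 m)=\{A:\mathcal R(A)=A\}$, $\mathbf{aPA}(n\times m)=\{A:\mathcal R(A)=-A\}$. A mapping is palindromicing (resp. antipalindromicing) by rows if it is an epimorphism from $\mathcal M_{n\times m}$ to $W_p^r(n\times m)$ (resp. $W_a^r(n\times m)$); by columns, to $W_p^c(n\times m)$ (resp. $W_a^c(n\times m)$); with respect to $\mathcal R$, to $\mathbf{PA}(n\times m)$ (resp. $\mathbf{aPA}(n\times m)$). A palindromicing and an antipalindromicing mapping by rows, $\mathcal F_p^r$ and $\mathcal F_a^r$, are canonical if they are linear and, for all $A$, $A=(\mathcal F_p^r+\mathcal F_a^r)(A)$ and $\mathcal R_r(A)=(\mathcal F_p^r-\mathcal F_a^r)(A)$; canonical mappings by columns, $\mathcal F_p^c,\mathcal F_a^c$, are defined identically with $\mathcal R_c$ in place of $\mathcal R_r$, and canonical mappings $\mathcal F_p,\mathcal F_a$ with $\mathcal R$ in place of $\mathcal R_r$.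
   Formalization: Part (3) is false as printed (for n=m=1, F_p^r(A)=A but A(M_R+I)=2A); it is proved with the factor 1/2 in the three palindromicing formulas, -1/2 in the three antipalindromicing ones, and with I_m in the row formulas and I_n in the column formulas. *)

(* Defs.v *)
From HB Require Import structures.
From mathcomp Require Import all_boot all_order all_algebra.

Set Implicit Arguments.
Unset Strict Implicit.
Unset Printing Implicit Defensive.

Import GRing.Theory.
Local Open Scope ring_scope.

(* Indices run from 0, so the 1-based index m + 1 - j is [rev_ord j]. *)

Section Reversals.
Variables (K : fieldType) (n m : nat).
Implicit Types A : 'M[K]_(n, m).

Definition rev_rows A := \matrix_(i < n, j < m) A i (rev_ord j).
Definition rev_cols A := \matrix_(i < n, j < m) A (rev_ord i) j.
Definition rev_mx A := \matrix_(i < n, j < m) A (rev_ord i) (rev_ord j).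

Lemma rev_mxE A : rev_mx A = rev_rows (rev_cols A).
Proof. by apply/matrixP=> i j; rewrite !mxE. Qed.

Fact rev_rows_is_linear : linear rev_rows.
Proof. by move=> a A B; apply/matrixP=> i j; rewrite !mxE. Qed.
Fact rev_cols_is_linear : linear rev_cols.
Proof. by move=> a A B; apply/matrixP=> i j; rewrite !mxE. Qed.
Fact rev_mx_is_linear : linear rev_mx.
Proof. by move=> a A B; apply/matrixP=> i j; rewrite !mxE. Qed.

HB.instance Definition _ := GRing.isLinear.Build K 'M[K]_(n, m) 'M[K]_(n, m)
  _ rev_rows rev_rows_is_linear.
HB.instance Definition _ := GRing.isLinear.Build K 'M[K]_(n, m) 'M[K]_(n, m)
  _ rev_cols rev_cols_is_linear.
HB.instance Definition _ := GRing.isLinear.Build K 'M[K]_(n, m) 'M[K]_(n, m)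
  _ rev_mx rev_mx_is_linear.

End Reversals.

(* The reversing matrix M_R of order k. *)
Definition reversing_mx (K : fieldType) (k : nat) : 'M[K]_k :=
  \matrix_(i, j) (i == rev_ord j)%:R.

Section Canonical.
Variables (K : fieldType) (n m : nat).
Local Notation M := 'M[K]_(n, m).

(* With R = rev_rows, rev_cols, rev_mx these are respectively               *)
(*   W_p^r, W_p^c, PA   (pal_space)   and   W_a^r, W_a^c, aPA (apal_space). *)
Definition pal_space (R : {linear M -> M}) : {vspace M} :=
  lker (linfun R - \1)%VF.
Definition apal_space (R : {linear M -> M}) : {vspace M} :=
  lker (linfun R + \1)%VF.

Lemma mem_pal_space R A : (A \in pal_space R) = (R A == A).
Proof. by rewrite memv_ker add_lfunE opp_lfunE id_lfunE lfunE subr_eq0. Qed.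

Lemma mem_apal_space R A : (A \in apal_space R) = (R A == - A).
Proof. by rewrite memv_ker add_lfunE id_lfunE lfunE addr_eq0. Qed.

(* An epimorphism onto a subspace W of M is an endomorphism with image W. *)
Definition palindromicing (R : {linear M -> M}) (F : 'End(M)) : Prop :=
  limg F = pal_space R.
Definition antipalindromicing (R : {linear M -> M}) (F : 'End(M)) : Prop :=
  limg F = apal_space R.

Definition canonical_pair (R : {linear M -> M}) (Fp Fa : 'End(M)) : Prop :=
  [/\ palindromicing R Fp, antipalindromicing R Fa,
      forall A, A = (Fp + Fa)%VF A
    & forall A, R A = (Fp - Fa)%VF A].

End Canonical.

(* Main.v *)
Require Import Defs.
From HB Require Import structures.
From mathcomp Require Import all_boot all_order all_algebra.

Set Implicit Arguments.
Unset Strict Implicit.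
Unset Printing Implicit Defensive.

Import GRing.Theory.
Local Open Scope ring_scope.

(** For any linear [R], the identities [A = Fp A + Fa A] and [R A = Fp A - Fa A] form a linear
    system in [Fp A] and [Fa A]. Characteristic zero makes 2 invertible, so the system has a unique
    solution, the half sum and half difference ([canonical_palE], [canonical_apalE]). Kernels are
    then read off as eigenspaces of [R] for 1 and -1, which are the prescribed images. When [R] is
    an involution the two halves are the projections onto these eigenspaces, so a canonical pair
    exists. The three reversals are involutions, and multiplication by the reversing matrix realises
    them, which turns (1) into (3). *)

Section CanonicalPairs.
Variables (K : fieldType) (n m : nat).
Local Notation M := 'M[K]_(n, m).
Hypothesis two_neq0 : 2 != 0 :> K.
Variable R : {linear M -> M}.

Lemma half_double (A : M) : 2^-1 *: (A + A) = A.
Proof. by rewrite -mulr2n -scaler_nat scalerA mulVf // scale1r. Qed.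

Lemma half_eq0 (A : M) : (2^-1 *: A == 0) = (A == 0).
Proof. by rewrite scaler_eq0 invr_eq0 (negPf two_neq0). Qed.

Section Uniqueness.
Variables Fp Fa : 'End(M).
Hypothesis FpFa : canonical_pair R Fp Fa.

Lemma canonical_palE A : Fp A = 2^-1 *: (A + R A).
Proof.
have [_ _ FD FB] := FpFa.
(* The left side of [FD] is a bare variable; the pattern confines the rewriting to the first
   summand. *)
rewrite FB [X in X + _]FD !add_lfunE opp_lfunE addrACA subrr addr0.
by rewrite half_double.
Qed.

Lemma canonical_apalE A : Fa A = 2^-1 *: (A - R A).
Proof.
have [_ _ FD FB] := FpFa.
rewrite FB [X in X - _]FD !add_lfunE opp_lfunE opprB [Fp A + _]addrC.
by rewrite addrACA subrr addr0 half_double.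
Qed.

(** Half of [A + R A] vanishes exactly when [R A = - A], and the surjectivity clause makes this
    eigenspace the image of [Fa]. *)
Lemma lker_canonical_pal : lker Fp = limg Fa.
Proof.
have [_ -> _ _] := FpFa; apply/vspaceP=> A.
by rewrite memv_ker canonical_palE half_eq0 mem_apal_space addrC addr_eq0.
Qed.

Lemma lker_canonical_apal : lker Fa = limg Fp.
Proof.
have [-> _ _ _] := FpFa; apply/vspaceP=> A.
by rewrite memv_ker canonical_apalE half_eq0 mem_pal_space subr_eq0 eq_sym.
Qed.

End Uniqueness.

Lemma canonical_pair_exists :
  involutive R -> exists Fp Fa : 'End(M), canonical_pair R Fp Fa.
Proof.
move=> RK.
pose Fp : 'End(M) := 2^-1 *: (\1 + linfun R)%VF.
pose Fa : 'End(M) := 2^-1 *: (\1 - linfun R)%VF.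
have FpE A : Fp A = 2^-1 *: (A + R A).
  by rewrite scale_lfunE add_lfunE id_lfunE lfunE.
have FaE A : Fa A = 2^-1 *: (A - R A).
  by rewrite scale_lfunE add_lfunE opp_lfunE id_lfunE lfunE.
exists Fp, Fa; split=> [||A|A].
- apply/vspaceP=> A; rewrite mem_pal_space.
  (* Since [R (R B) = B], applying [R] swaps the summands of [B + R B]; conversely, a fixed [A] is
     its own preimage. *)
  apply/memv_imgP/eqP=> [[B _ ->]|RA].
    by rewrite FpE linearZ linearD RK addrC.
  by exists A; rewrite ?memvf // FpE RA half_double.
- apply/vspaceP=> A; rewrite mem_apal_space.
  apply/memv_imgP/eqP=> [[B _ ->]|RA].
    by rewrite FaE linearZ linearB RK -scalerN opprB.
  by exists A; rewrite ?memvf // FaE RA opprK half_double.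
- by rewrite add_lfunE FpE FaE -scalerDr addrACA subrr addr0 half_double.
- rewrite add_lfunE opp_lfunE FpE FaE -scalerBr opprB [A + _]addrC.
  by rewrite addrACA subrr addr0 half_double.
Qed.

End CanonicalPairs.

Section ReversingMatrix.
Variables (K : fieldType) (n m : nat).
Implicit Types A : 'M[K]_(n, m).

Lemma rev_rowsK : involutive (@rev_rows K n m).
Proof. by move=> A; apply/matrixP=> i j; rewrite !mxE rev_ordK. Qed.

Lemma rev_colsK : involutive (@rev_cols K n m).
Proof. by move=> A; apply/matrixP=> i j; rewrite !mxE rev_ordK. Qed.

Lemma rev_mxK : involutive (@rev_mx K n m).
Proof. by move=> A; apply/matrixP=> i j; rewrite !mxE !rev_ordK. Qed.

Lemma mulmx_reversing A : A *m reversing_mx K m = rev_rows A.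
Proof.
apply/matrixP=> i j; rewrite !mxE (bigD1 (rev_ord j)) //= mxE eqxx mulr1.
by rewrite big1 ?addr0 // => k /negPf kj; rewrite mxE kj mulr0.
Qed.

Lemma mul_reversing_mx A : reversing_mx K n *m A = rev_cols A.
Proof.
apply/matrixP=> i j; rewrite !mxE (bigD1 (rev_ord i)) //= mxE rev_ordK eqxx.
rewrite mul1r big1 ?addr0 // => k /negPf ki.
(* The entry tests [i == rev_ord k], while [ki] concerns [k] and [rev_ord i]; applying [rev_ord] to
   both sides matches them. *)
by rewrite mxE -(inj_eq rev_ord_inj) rev_ordK eq_sym ki mul0r.
Qed.

End ReversingMatrix.

(** The scalars in (3) are forced by (1): multiplying [A] by the reversing matrix plus or minus the
    identity gives [R A + A] or [R A - A], that is, [Fp A] doubled or [Fa A] times -2. The identity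
    has order [m] on the right of [A] and [n] on the left. *)
Theorem proposition2p16 (K : fieldType) (charK : [pchar K] =i pred0)
    (n m : nat) :
  (* the canonical mappings exist *)
  [/\ exists Fp Fa : 'End('M[K]_(n, m)), canonical_pair (@rev_rows K n m) Fp Fa,
      exists Fp Fa : 'End('M[K]_(n, m)), canonical_pair (@rev_cols K n m) Fp Fa
    & exists Fp Fa : 'End('M[K]_(n, m)), canonical_pair (@rev_mx K n m) Fp Fa]
  /\
  forall Fpr Far Fpc Fac Fp Fa : 'End('M[K]_(n, m)),
    canonical_pair (@rev_rows K n m) Fpr Far ->
    canonical_pair (@rev_cols K n m) Fpc Fac ->
    canonical_pair (@rev_mx K n m) Fp Fa ->
    [/\ (* (1) *)
      forall A : 'M[K]_(n, m),
        (Fpr A = 2^-1 *: (A + rev_rows A)) /\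
        (Far A = 2^-1 *: (A - rev_rows A)) /\
        (Fpc A = 2^-1 *: (A + rev_cols A)) /\
        (Fac A = 2^-1 *: (A - rev_cols A)) /\
        (Fp A = 2^-1 *: (A + rev_mx A)) /\
        (Fa A = 2^-1 *: (A - rev_mx A)),
      (* (2) *)
        (lker Fpr = limg Far) /\ (lker Far = limg Fpr) /\
        (lker Fpc = limg Fac) /\ (lker Fac = limg Fpc) /\
        (lker Fp = limg Fa) /\ (lker Fa = limg Fp)
    & (* (3) *)
      forall A : 'M[K]_(n, m),
        (Fpr A = 2^-1 *: (A *m (reversing_mx K m + 1%:M))) /\
        (Far A = - 2^-1 *: (A *m (reversing_mx K m - 1%:M))) /\
        (Fpc A = 2^-1 *: ((reversing_mx K n + 1%:M) *m A)) /\
        (Fac A = - 2^-1 *: ((reversing_mx K n - 1%:M) *m A)) /\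
        (Fp A = 2^-1 *: (reversing_mx K n *m A *m reversing_mx K m + A)) /\
        (Fa A = - 2^-1 *: (reversing_mx K n *m A *m reversing_mx K m - A))].
Proof.
have two_neq0 : 2 != 0 :> K by rewrite (pcharf0P K).1.
split.
  by split; apply: canonical_pair_exists => //;
    [exact: rev_rowsK | exact: rev_colsK | exact: rev_mxK].
move=> Fpr Far Fpc Fac Fp Fa cr cc c.
split=> [A||A].
- rewrite (canonical_palE two_neq0 cr) (canonical_apalE two_neq0 cr).
  rewrite (canonical_palE two_neq0 cc) (canonical_apalE two_neq0 cc).
  by rewrite (canonical_palE two_neq0 c) (canonical_apalE two_neq0 c).
- rewrite (lker_canonical_pal two_neq0 cr) (lker_canonical_apal two_neq0 cr).
  rewrite (lker_canonical_pal two_neq0 cc) (lker_canonical_apal two_neq0 cc).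
  by rewrite (lker_canonical_pal two_neq0 c) (lker_canonical_apal two_neq0 c).
- rewrite (canonical_palE two_neq0 cr) (canonical_apalE two_neq0 cr).
  rewrite (canonical_palE two_neq0 cc) (canonical_apalE two_neq0 cc).
  rewrite (canonical_palE two_neq0 c) (canonical_apalE two_neq0 c).
  (* Expanding the products reduces (3) to (1); the minus sign moves inside to reverse each
     difference. *)
  rewrite mulmxDr mulmxBr mulmxDl mulmxBl !mulmx1 !mul1mx.
  rewrite mul_reversing_mx !mulmx_reversing -rev_mxE !scaleNr -!scalerN !opprB.
  by do !split; rewrite // addrC.
Qed.
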